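(* Let $p$ be a prime and let $(\mathcal{L},\Delta,S)$ be a locality, with domain $\mathbb{D}(\mathcal{L})$ and partial product $\Pi:\mathbb{D}(\mathcal{L})\to\mathcal{L}$. Let $\Delta^e\subseteq\Delta$ be the set of $\mathcal{L}$-essential subgroups of $S$. Then, for every $g\in\mathcal{L}$, there exist $Q_1,Q_2,\dots,Q_n\in\Delta^e\cup\{S\}$ and a word $w=(g_1,g_2,\dots,g_n)\in\mathbb{D}(\mathcal{L})$ such that (a) for every $i\in\{1,2,\dots,n\}$, $g_i\in N_{\mathcal{L}}(Q_i)$ and $S_{g_i}=Q_i$; and (b) $S_w=S_g$ and $g=\Pi(w)$.
   Context: Partial groups (Chermak). For a set $\mathcal{L}$ let $W(\mathcal{L})$ be the free monoid of finite words in $\mathcal{L}$, with concatenation $\circ$ and empty word $\emptyset$; elements of $\mathcal{L}$ are identified with words of length one. A partial group is a non-empty set $\mathcal{L}$ with a subset $\mathbb{D}(\mathcal{L})\subseteq W(\mathcal{L})$ (the domain), a map $\Pi:\mathbb{D}(\mathcal{L})\to\mathcal{L}$ (the partial product), and an involutory bijection $g\mapsto g^{-1}$ of $\mathcal{L}$, extended to words by $(g_1,\dots,g_n)^{-1}=(g_n^{-1},\dots,g_1^{-1})$, such that: (1) $\mathcal{L}\subseteq\mathbb{D}(\mathcal{L})$, and $u\circ v\in\mathbb{D}(\mathcal{L})$ implies $u,v\in\mathbb{D}(\mathcal{L})$; (2) $\Pi$ restricts to the identity on $\mathcal{L}$; (3) if $u\circ v\circ w\in\mathbb{D}(\mathcal{L})$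 then $u\circ(\Pi(v))\circ w\in\mathbb{D}(\mathcal{L})$ and $\Pi(u\circ v\circ w)=\Pi(u\circ(\Pi(v))\circ w)$; (4) if $w\in\mathbb{D}(\mathcal{L})$ then $w^{-1}\circ w\in\mathbb{D}(\mathcal{L})$ and $\Pi(w^{-1}\circ w)=1$, where $1=\Pi(\emptyset)$. A subgroup of $\mathcal{L}$ is a non-empty subset $H$ closed under inversion, with $W(H)\subseteq\mathbb{D}(\mathcal{L})$ and $\Pi(w)\in H$ for all $w\in W(H)$ (then $H$ is a group under $\Pi$); it is a $p$-subgroup if it is a finite $p$-group. For $x,g\in\mathcal{L}$ with $(g^{-1},x,g)\in\mathbb{D}(\mathcal{L})$ put $x^g=\Pi(g^{-1},x,g)$. For $X\subseteq\mathcal{L}$, ''$X^g$ is defined'' means $x^g$ is defined for all $x\in X$, and then $X^g=\{x^g\mid x\in X\}$. For a subgroup $P$, $N_{\mathcal{L}}(P)=\{g\in\mathcal{L}\mid P^g\text{ is defined and }P^g=P\}$. Localities. A triple $(\mathcal{L},\Delta,S)$ is a locality if $\mathcal{L}$ is a finite partial group, $S$ is a $p$-subgroup of $\mathcal{L}$, $\Delta$ is a set of subgroups of $S$ with $S\in\Delta$, and: (O1) $\mathbb{D}(\mathcal{L})$ is exactly the set of words $(g_1,\dots,g_n)$ for which there exist $X_0,\dots,X_n\in\Delta$ such that, for each $1\le i\le n$, $X_{i-1}^{g_i}$ is defined and equals $X_i$; (O2) if $X,Y\in\Delta$ and $g\in\mathcal{L}$ are such that $X^g$ is defined and is a subgroup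 of $Y$, then every subgroup of $Y$ containing $X^g$ is in $\Delta$; (L) $S$ is maximal, with respect to inclusion, among the $p$-subgroups of $\mathcal{L}$. For $P\in\Delta$, $N_{\mathcal{L}}(P)$ is a (finite) subgroup of $\mathcal{L}$ in which $P$ is normal. For $g\in\mathcal{L}$, $S_g=\{s\in S\mid (g^{-1},s,g)\in\mathbb{D}(\mathcal{L})\text{ and }s^g\in S\}$. For a word $w=(g_1,\dots,g_r)$, $S_w$ is the set of $s\in S$ such that $(g_1^{-1},s,g_1)\in\mathbb{D}(\mathcal{L})$ and $s^{g_1}\in S$, $(g_2^{-1},s^{g_1},g_2)\in\mathbb{D}(\mathcal{L})$ and $(s^{g_1})^{g_2}\in S$, and so on through $g_r$. A subgroup $H$ of a finite group $G$ is strongly $p$-embedded if $H<G$ (proper), $p$ divides $|H|$, and for every $g\in G\smallsetminus H$, $p$ does not divide $|H\cap H^g|$. A subgroup $P\in\Delta$ is $\mathcal{L}$-essential if (i) $N_S(P)$ is a Sylow $p$-subgroup of $N_{\mathcal{L}}(P)$, and (ii) $N_{\mathcal{L}}(P)/P$ contains a strongly $p$-embedded subgroup. *)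

(* Defs.v *)
From HB Require Import structures.
From mathcomp Require Import all_boot all_order all_fingroup all_solvable.

Set Implicit Arguments.
Unset Strict Implicit.
Unset Printing Implicit Defensive.

Import GroupScope.

(* [pdom] is the domain D and [part_prod] the partial product.  [part_prod] is
   a total function on words, but its values outside [pdom] are unconstrained
   and never used.  Non-emptiness of the carrier is witnessed by
   [part_prod [::]]. *)
HB.mixin Record isPartialGroup L of Choice L := {
  pdom : pred (seq L);
  part_prod : seq L -> L;
  pinv : L -> L;
  pinvK : involutive pinv;
  pdom1 : forall x, pdom [:: x];
  pdom_cat : forall u v, pdom (u ++ v) -> pdom u /\ pdom v;
  part_prod1 : forall x, part_prod [:: x] = x;
  part_prod_subst : forall u v w, pdom (u ++ v ++ w) ->
    pdom (u ++ part_prod v :: w) /\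
    part_prod (u ++ v ++ w) = part_prod (u ++ part_prod v :: w);
  part_prod_inv : forall w, pdom w ->
    pdom (rev (map pinv w) ++ w) /\
    part_prod (rev (map pinv w) ++ w) = part_prod [::]
}.

#[short(type="partialGroupType")]
HB.structure Definition PartialGroup := { L of isPartialGroup L & Choice L }.

#[short(type="finPartialGroupType")]
HB.structure Definition FinPartialGroup :=
  { L of isPartialGroup L & Finite L }.

Arguments pdom_cat {_} {u v} _.
Arguments part_prod_subst {_} {u v w} _.
Arguments part_prod_inv {_} {w} _.

Section WordLemmas.
Variable L : partialGroupType.
Implicit Types (x y g : L) (u v w : seq L).

Definition winv w : seq L := rev (map pinv w).

Lemma winvK : involutive winv.
Proof.
move=> w; rewrite /winv map_rev revK -map_comp -[RHS]map_id.
by apply: eq_map => x /=; rewrite pinvK.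
Qed.

Lemma winv_cat u v : winv (u ++ v) = winv v ++ winv u.
Proof. by rewrite /winv map_cat rev_cat. Qed.

Lemma pdom_prefix u v : pdom (u ++ v) -> pdom u.
Proof. by case/pdom_cat. Qed.

Lemma pdom_suffix u v : pdom (u ++ v) -> pdom v.
Proof. by case/pdom_cat. Qed.

Lemma pdom_winv w : pdom w -> pdom (winv w).
Proof. by case/part_prod_inv=> /pdom_prefix. Qed.

Lemma pdom_inv_cat w : pdom w -> pdom (w ++ winv w ++ w ++ winv w).
Proof.
move=> /pdom_winv Dw; case: (part_prod_inv Dw); rewrite -/(winv _) winvK => D _.
by case: (part_prod_inv D); rewrite -/(winv _) winv_cat winvK -catA.
Qed.

Lemma part_prod_winv w : pdom w -> part_prod (winv w) = pinv (part_prod w).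
Proof.
move=> Dw; set a := part_prod (winv w); set b := part_prod w.
have /part_prod_inv[_] := Dw; rewrite -/(winv w) => E1.
have D4 : pdom (winv w ++ w ++ winv w).
  by move: (pdom_inv_cat Dw) => /pdom_suffix.
have D5 : pdom [:: a; b].
  have D2 := (part_prod_inv Dw).1; rewrite -/(winv w) in D2.
  have [D3 _] := @part_prod_subst L [::] (winv w) w D2.
  have := @part_prod_subst L [:: a] w [::]; rewrite cats0 => /(_ D3)[D _].
  exact: D.
have Eab : part_prod [:: a; b] = part_prod [::].
  have D2 := (part_prod_inv Dw).1; rewrite -/(winv w) in D2.
  have [D3 E3] := @part_prod_subst L [::] (winv w) w D2.
  have := @part_prod_subst L [:: a] w [::]; rewrite cats0 => /(_ D3)[_ E].
  by rewrite -E1 E3 /= E.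
have D6 : pdom [:: a; b; pinv b].
  have /= D := pdom_inv_cat (w := [:: pinv b; pinv a]).
  have Dba : pdom [:: pinv b; pinv a] by have := pdom_winv D5.
  move: (D Dba); rewrite /winv /rev /= !pinvK.
  move=> /(@pdom_suffix [:: _; _]) D'.
  exact: (@pdom_prefix [:: a; b; pinv b] _ D').
have [_ E7] := @part_prod_subst L [::] [:: a; b] [:: pinv b] D6.
have Dbb : pdom [:: b; pinv b] by exact: (@pdom_suffix [:: a] _ D6).
have Ebb : part_prod [:: b; pinv b] = part_prod [::].
  by have [_] := part_prod_inv (pdom1 (pinv b)); rewrite /rev /= pinvK.
have [_ E8] := @part_prod_subst L [:: a] [:: b; pinv b] [::] D6.
have [_ E9] := @part_prod_subst L [:: a] [::] [::] (pdom1 a).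
have [_ E10] := @part_prod_subst L [::] [::] [:: pinv b] (pdom1 _).
move: E7; rewrite /= in E8 E9 E10 *.
by rewrite E8 Ebb -E9 part_prod1 Eab -E10 part_prod1.
Qed.

End WordLemmas.

Section PartialGroupTheory.
Variable L : finPartialGroupType.
Implicit Types (x y g : L) (u v w : seq L) (H P X Y : {set L}).

Record is_subgroup H : Prop := IsSubgroup {
  subgroup_neq0 : H != set0;
  subgroup_inv : forall x, x \in H -> pinv x \in H;
  subgroup_dom : forall w, {subset w <= H} -> pdom w;
  subgroup_prod : forall w, {subset w <= H} -> part_prod w \in H
}.

Definition is_psubgroup (p : nat) H : Prop := is_subgroup H /\ p.-nat #|H|.

Definition conj_word x g : seq L := [:: pinv g; x; g].

(* x^g; meaningful only when [pdom (conj_word x g)]. *)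
Definition pconj x g : L := part_prod (conj_word x g).

Definition conj_defined X g : bool := [forall x in X, pdom (conj_word x g)].

(* Meaningful only together with [conj_defined X g]. *)
Definition conj_set X g : {set L} := [set pconj x g | x in X].

Definition pnorm P : {set L} :=
  [set g | conj_defined P g && (conj_set P g == P)].

Definition conj_in (S : {set L}) x g : bool :=
  pdom (conj_word x g) && (pconj x g \in S).

Definition S_elt (S : {set L}) g : {set L} := [set s in S | conj_in S s g].

Fixpoint conj_in_word (S : {set L}) x w : bool :=
  if w is g :: w' then conj_in S x g && conj_in_word S (pconj x g) w'
  else true.

Definition S_word (S : {set L}) w : {set L} :=
  [set s in S | conj_in_word S s w].

Record locality (p : nat) (Delta : {set {set L}}) (S : {set L}) : Prop :=
  Locality {
    loc_S : is_psubgroup p S;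
    loc_Delta : forall X, X \in Delta -> is_subgroup X /\ X \subset S;
    loc_SDelta : S \in Delta;
    loc_O1 : forall w, pdom w <->
      exists X : nat -> {set L},
        (forall i, i <= size w -> X i \in Delta) /\
        (forall i, i < size w ->
           let g := nth (part_prod [::]) w i in
           conj_defined (X i) g /\ conj_set (X i) g = X i.+1);
    loc_O2 : forall X Y g, X \in Delta -> Y \in Delta ->
      conj_defined X g -> is_subgroup (conj_set X g) ->
      conj_set X g \subset Y ->
      forall Z, is_subgroup Z -> Z \subset Y -> conj_set X g \subset Z ->
      Z \in Delta;
    loc_L : forall Q, is_psubgroup p Q -> S \subset Q -> Q = S
  }.

(* A subgroup of a partial group, as a MathComp finite group. *)
Definition subgroup_type H (sgH : is_subgroup H) : Type := {x : L | x \in H}.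

Section SubgroupType.
Variables (H : {set L}) (sgH : is_subgroup H).
Local Notation gT := (subgroup_type sgH).

HB.instance Definition _ := [isSub for (@sval L (fun x => x \in H) : gT -> L)].
HB.instance Definition _ := [Finite of gT by <:].

Lemma sg_sub2 (a b : L) : a \in H -> b \in H -> {subset [:: a; b] <= H}.
Proof. by move=> Ha Hb x; rewrite !inE => /orP[]/eqP->. Qed.

Lemma sg_sub0 : {subset ([::] : seq L) <= H}. Proof. by []. Qed.

Definition sg_mul (x y : gT) : gT :=
  exist _ (part_prod [:: val x; val y])
    (subgroup_prod sgH (sg_sub2 (valP x) (valP y))).
Definition sg_one : gT := exist _ (part_prod [::]) (subgroup_prod sgH sg_sub0).
Definition sg_inv (x : gT) : gT :=
  exist _ (pinv (val x)) (subgroup_inv sgH (valP x)).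

Lemma sg_mulA : associative sg_mul.
Proof.
move=> x y z; apply: val_inj => /=.
have D : pdom [:: val x; val y; val z].
  apply: (subgroup_dom sgH) => t; rewrite !inE.
  by case/or3P=> /eqP->; apply: valP.
have [_ /= E1] := @part_prod_subst L [::] [:: val x; val y] [:: val z] D.
have [_ /= E2] := @part_prod_subst L [:: val x] [:: val y; val z] [::] D.
by rewrite -E1 E2.
Qed.

Lemma sg_mul1 : left_id sg_one sg_mul.
Proof.
move=> x; apply: val_inj => /=.
have [_ /= E] := @part_prod_subst L [::] [::] [:: val x] (pdom1 _).
by rewrite -E part_prod1.
Qed.

Lemma sg_mulV : left_inverse sg_one sg_inv sg_mul.
Proof.
move=> x; apply: val_inj => /=.
by have [_] := part_prod_inv (pdom1 (val x)).
Qed.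

HB.instance Definition _ := Finite_isGroup.Build gT sg_mulA sg_mul1 sg_mulV.

Definition to_subgroup X : {set gT} := [set x : gT | val x \in X].

End SubgroupType.

Lemma pconjK x g : pdom (conj_word x g) ->
  pdom (conj_word (pconj x g) (pinv g)) /\ pconj (pconj x g) (pinv g) = x.
Proof.
move=> D.
have D9 := pdom_inv_cat (pdom_winv D); rewrite winvK in D9.
have {}D9 : pdom [:: g; pinv g; x; g; pinv g].
  move: D9; rewrite /winv /conj_word /rev /= !pinvK.
  move=> /(@pdom_suffix _ [:: _; _]).
  exact: (@pdom_prefix _ [:: g; pinv g; x; g; pinv g]).
have [D3 /= E3] :=
  @part_prod_subst L [:: g] [:: pinv g; x; g] [:: pinv g] D9.
have Ew : conj_word (pconj x g) (pinv g) = [:: g; pconj x g; pinv g].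
  by rewrite /conj_word pinvK.
rewrite /(pconj _ (pinv g)) Ew; split; first exact: D3.
rewrite -[LHS]E3.
have Egg : part_prod [:: g; pinv g] = part_prod [::].
  by have [_] := part_prod_inv (pdom1 (pinv g)); rewrite /rev /= pinvK.
have [D4 /= ->] :=
  @part_prod_subst L [::] [:: g; pinv g] [:: x; g; pinv g] D9.
have [_ /= ->] :=
  @part_prod_subst L [:: part_prod [:: g; pinv g]; x] [:: g; pinv g] [::] D4.
rewrite Egg.
have [D5 /= E5] := @part_prod_subst L [::] [::] [:: x] (pdom1 x).
have [_ /= E6] := @part_prod_subst L [:: part_prod [::]; x] [::] [::] D5.
by rewrite -E6 -E5 part_prod1.
Qed.

Lemma pnormP P g : reflect
  ((forall x, x \in P -> pdom (conj_word x g)) /\ conj_set P g = P)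
  (g \in pnorm P).
Proof.
rewrite inE; apply: (iffP andP) => -[D E].
  by split; [exact/forall_inP | exact/eqP].
by split; [exact/forall_inP | exact/eqP].
Qed.

Lemma pnorm_conj P g x : g \in pnorm P -> x \in P -> pconj x g \in P.
Proof. by case/pnormP=> _ {2}<- xP; apply: imset_f. Qed.

Lemma pnorm_of P g : (forall x, x \in P -> pdom (conj_word x g)) ->
  (forall x, x \in P -> pconj x g \in P) -> g \in pnorm P.
Proof.
move=> D C; apply/pnormP; split=> //; apply/eqP.
rewrite eqEcard; apply/andP; split.
  by apply/subsetP=> _ /imsetP[x xP ->]; apply: C.
rewrite card_in_imset // => x y xP yP E.
by rewrite -(pconjK (D x xP)).2 E (pconjK (D y yP)).2.
Qed.

Lemma pnorm_inv P g : g \in pnorm P -> pinv g \in pnorm P.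
Proof.
case/pnormP=> D E; apply: pnorm_of => x; rewrite -{1}E => /imsetP[y yP ->].
  by case: (pconjK (D y yP)).
by rewrite (pconjK (D y yP)).2.
Qed.

Lemma sub_pnorm P : is_subgroup P -> P \subset pnorm P.
Proof.
move=> sgP; apply/subsetP=> g gP.
have sub x : x \in P -> {subset conj_word x g <= P}.
  move=> xP t; rewrite !inE => /or3P[]/eqP-> //; exact: subgroup_inv.
apply: pnorm_of => x /sub; first exact: subgroup_dom.
exact: subgroup_prod.
Qed.

Lemma pnorm_subgroup p Delta S P : locality p Delta S -> P \in Delta ->
  is_subgroup (pnorm P).
Proof.
move=> loc PD; have [sgP _] := loc_Delta loc PD.
have dom w : {subset w <= pnorm P} -> pdom w.
  move=> sub; apply/(loc_O1 loc); exists (fun=> P); split=> // i lti /=.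
  by have /sub := mem_nth (part_prod [::]) lti; rewrite inE => /andP[-> /eqP].
have prodN w : {subset w <= pnorm P} -> part_prod w \in pnorm P.
  move=> sub; have Dw := dom _ sub.
  have subi : {subset winv w <= pnorm P}.
    move=> t; rewrite mem_rev => /mapP[z /sub zN ->]; exact: pnorm_inv.
  have big x : x \in P -> pdom (conj_word x (part_prod w)) /\
      pconj x (part_prod w) = part_prod (winv w ++ x :: w).
    move=> xP; have D : pdom (winv w ++ x :: w).
      apply: dom => t; rewrite mem_cat inE => /or3P[/subi|/eqP->|/sub] //.
      exact: (subsetP (sub_pnorm sgP)).
    have [D1 E1] := @part_prod_subst L [::] (winv w) (x :: w) D.
    have := @part_prod_subst L [:: part_prod (winv w); x] w [::].
    rewrite cats0 => /(_ D1)[D2 E2].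
    by rewrite /pconj /conj_word -part_prod_winv //; split; rewrite ?E1 ?E2.
  apply: pnorm_of => x xP; first by case: (big x xP).
  rewrite (big x xP).2.
  elim: w {Dw} sub subi {big} x xP => [|g w IH] sub subi x xP.
    by rewrite /= part_prod1.
  have gN : g \in pnorm P by apply: sub; rewrite mem_head.
  have sub' : {subset w <= pnorm P}.
    by move=> t tw; apply: sub; rewrite inE tw orbT.
  have Ew : winv (g :: w) = winv w ++ [:: pinv g].
    by rewrite -cat1s winv_cat.
  have D : pdom (winv w ++ conj_word x g ++ w).
    have -> : winv w ++ conj_word x g ++ w = winv (g :: w) ++ x :: g :: w.
      by rewrite Ew -catA.
    apply: dom => t; rewrite mem_cat inE => /or3P[/subi|/eqP->|/sub] //.
    exact: (subsetP (sub_pnorm sgP)).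
  rewrite Ew -catA; have [_ /= ->] := part_prod_subst D.
  apply: (IH sub' _ (pconj x g)); last exact: pnorm_conj.
  by move=> t tw; apply: subi; rewrite Ew mem_cat tw.
split=> //; last exact: pnorm_inv.
by apply/set0Pn; exists (part_prod [::]); apply: prodN.
Qed.

End PartialGroupTheory.

Definition strongly_embedded (p : nat) (gT : finGroupType) (G H : {group gT}) :=
  [/\ H \proper G, p %| #|H|
    & forall g, g \in G :\: H -> ~~ (p %| #|H :&: H :^ g|)].

(* [N] is N_L(P) as a finite group; [to_subgroup sgN X] is the intersection of
   X with N_L(P), so for X = S it is N_S(P).  As P is normal in N, the quotient
   [N / to_subgroup sgN P] is the usual one. *)
Definition essential (L : finPartialGroupType) (p : nat)
    (Delta : {set {set L}}) (S : {set L}) (loc : locality p Delta S)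
    (P : {set L}) : Prop :=
  exists PD : P \in Delta,
    let sgN := pnorm_subgroup loc PD in
    let N := [set: subgroup_type sgN]%G in
    p.-Sylow(N) (to_subgroup sgN S) /\
    exists H : {group coset_of (to_subgroup sgN P)},
      strongly_embedded p (N / to_subgroup sgN P)%G H.

(* Main.v *)
Require Import Defs.
From mathcomp Require Import all_boot all_order all_fingroup all_solvable.

(* Alperin-Goldschmidt induction, downwards on |S_g|.  Put P = S_g < S and
   choose a conjugate R of P with N_S(R) Sylow in N_L(R).  Sylow's theorem in
   N_L(R) gives elements h and k carrying P and Q = P^g to R and defined on
   N_S(P) and N_S(Q), so that g = h x k^-1 with x in N_L(R), and h, k fall under
   the induction hypothesis.  If S_x = R, write T = N_S(R) and let X be the set
   of y in N_L(R) with R < T :&: T^(y^-1); then either X generates N_L(R) and x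
   is a product of elements to which induction applies, or <X>/R is strongly
   p-embedded in N_L(R)/R, R is essential and x is a single admissible factor. *)

Set Implicit Arguments.
Unset Strict Implicit.
Unset Printing Implicit Defensive.

Import GroupScope.

(** * Cancellation in words of a partial group *)

Section PartialGroupWords.
Variable L : partialGroupType.
Implicit Types (x y g : L) (u v w : seq L).

Lemma pdom_mid u v w : pdom (u ++ v ++ w) -> pdom v.
Proof. by move/pdom_suffix/pdom_prefix. Qed.

Lemma part_prod_cat u v : pdom (u ++ v) ->
  part_prod (u ++ v) = part_prod [:: part_prod u; part_prod v].
Proof.
move=> D; have [D1 /= E1] := @part_prod_subst L [::] u v D.
have := @part_prod_subst L [:: part_prod u] v [::].
by rewrite cats0 => /(_ D1)[_ /= E2]; rewrite E1 -E2.
Qed.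

Lemma part_prod1l x : part_prod [:: part_prod [::]; x] = x.
Proof.
by have [_ /= <-] := @part_prod_subst L [::] [::] [:: x] (pdom1 x);
  rewrite part_prod1.
Qed.

Lemma part_prod1r x : part_prod [:: x; part_prod [::]] = x.
Proof.
by have [_ /= <-] := @part_prod_subst L [:: x] [::] [::] (pdom1 x);
  rewrite part_prod1.
Qed.

Lemma part_prodVl x : part_prod [:: pinv x; x] = part_prod [::].
Proof. by have [_] := part_prod_inv (pdom1 x). Qed.

Lemma part_prodVr x : part_prod [:: x; pinv x] = part_prod [::].
Proof. by have := part_prodVl (pinv x); rewrite pinvK. Qed.

Lemma pinv1 : pinv (part_prod [::]) = part_prod [::] :> L.
Proof. by rewrite -[LHS]part_prod1r part_prodVl. Qed.

Lemma part_prodKl x y :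
  pdom [:: x; pinv x; y] -> part_prod [:: x; pinv x; y] = y.
Proof.
move=> D; have [_ /= ->] := @part_prod_subst L [::] [:: x; pinv x] [:: y] D.
by rewrite part_prodVr part_prod1l.
Qed.

Lemma part_prodVKl x y :
  pdom [:: pinv x; x; y] -> part_prod [:: pinv x; x; y] = y.
Proof. by move=> D; rewrite -{2}(pinvK x) part_prodKl // pinvK. Qed.

Lemma part_prodKr x y :
  pdom [:: y; x; pinv x] -> part_prod [:: y; x; pinv x] = y.
Proof.
move=> D; have [_ /= ->] := @part_prod_subst L [:: y] [:: x; pinv x] [::] D.
by rewrite part_prodVr part_prod1r.
Qed.

Lemma winv_cons x w : winv (x :: w) = rcons (winv w) (pinv x).
Proof. by rewrite /winv /= rev_cons. Qed.

End PartialGroupWords.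

(** * Conjugation of elements and of subgroups *)

Section Conjugation.
Variable L : finPartialGroupType.
Implicit Types (x y g : L) (u v w : seq L) (H P X Y : {set L}).

Lemma winv_conj_word x g : winv (conj_word x g) = conj_word (pinv x) g.
Proof. by rewrite /winv /conj_word /rev /= pinvK. Qed.

Lemma pconj_inv x g : pdom (conj_word x g) ->
  pdom (conj_word (pinv x) g) /\ pconj (pinv x) g = pinv (pconj x g).
Proof.
move=> D; rewrite /pconj -winv_conj_word part_prod_winv //.
by split=> //; exact: pdom_winv.
Qed.

Lemma pconj1l g : pdom (conj_word (part_prod [::]) g) /\
  pconj (part_prod [::]) g = part_prod [::].
Proof.
have [D E] := part_prod_inv (pdom1 g); rewrite /rev /= in D E.
have [D1 E1] := @part_prod_subst L [:: pinv g] [::] [:: g] D.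
by split=> //; rewrite /pconj -E1.
Qed.

Lemma pconj1r x : pdom (conj_word x (part_prod [::])) /\
  pconj x (part_prod [::]) = x.
Proof.
have [D1 E1] := @part_prod_subst L [::] [::] [:: x] (pdom1 x).
have [D2 E2] := @part_prod_subst L [:: part_prod [::]; x] [::] [::] D1.
by rewrite /pconj /conj_word pinv1; split=> //; rewrite -E2 -E1 part_prod1.
Qed.

Lemma foldl_pconj x w : pdom (winv w ++ x :: w) ->
  part_prod (winv w ++ x :: w) = foldl (@pconj L) x w.
Proof.
elim: w x => [|g w IH] x /=; first by rewrite part_prod1.
rewrite winv_cons cat_rcons => D.
have [D1 ->] := @part_prod_subst L (winv w) [:: pinv g; x; g] w D.
exact: IH.
Qed.

Lemma pconj_prod x w : pdom w -> pdom (winv w ++ x :: w) ->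
  pdom (conj_word x (part_prod w)) /\
  pconj x (part_prod w) = foldl (@pconj L) x w.
Proof.
move=> Dw D; rewrite -foldl_pconj //.
have [D1 E1] := @part_prod_subst L [::] (winv w) (x :: w) D.
have := @part_prod_subst L [:: part_prod (winv w); x] w [::].
rewrite cats0 => /(_ D1)[D2 E2].
by rewrite /pconj /conj_word -part_prod_winv //; split; rewrite ?E1 ?E2.
Qed.

(** The hypothesis puts both conjugation words into one word of the domain, where the inner letters
    [g], [pinv g] cancel. *)
Lemma pconjM x y g : pdom (conj_word x g ++ conj_word y g) ->
  pdom (conj_word (part_prod [:: x; y]) g) /\
  pconj (part_prod [:: x; y]) g = part_prod [:: pconj x g; pconj y g].
Proof.
move=> D; rewrite /(pconj x) /(pconj y) -part_prod_cat //.
have [D1 /= ->] :=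
  @part_prod_subst L [:: pinv g; x] [:: g; pinv g; y] [:: g] D.
move: D1; rewrite part_prodKl; last first.
  exact: (@pdom_mid _ [:: pinv g; x] [:: g; pinv g; y] [:: g]).
move=> D1.
by have [] := @part_prod_subst L [:: pinv g] [:: x; y] [:: g] D1.
Qed.

Lemma pconj_inj g :
  {in [pred x | pdom (conj_word x g)] &, injective (@pconj L ^~ g)}.
Proof.
by move=> x y /pconjK[_ {2}<-] /pconjK[_ {2}<-] /= ->.
Qed.

Lemma card_conj_set X g : conj_defined X g -> #|conj_set X g| = #|X|.
Proof.
move=> /forall_inP D; apply: card_in_imset => x y xX yX.
by apply: pconj_inj; rewrite inE D.
Qed.

Lemma mem_conj_set X g x : x \in X -> pconj x g \in conj_set X g.
Proof. exact: imset_f. Qed.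

Lemma conj_setK X g : conj_defined X g ->
  conj_defined (conj_set X g) (pinv g) /\ conj_set (conj_set X g) (pinv g) = X.
Proof.
move=> /forall_inP D; split.
  by apply/forall_inP=> _ /imsetP[x xX ->]; case: (pconjK (D x xX)).
rewrite /conj_set -imset_comp -[RHS]imset_id.
by apply: eq_in_imset => x xX /=; case: (pconjK (D x xX)).
Qed.

Lemma is_subgroup1 H : is_subgroup H -> part_prod [::] \in H.
Proof. by move=> sgH; apply: (subgroup_prod sgH). Qed.

Lemma is_subgroupM H x y : is_subgroup H -> x \in H -> y \in H ->
  part_prod [:: x; y] \in H.
Proof. by move=> sgH xH yH; apply/(subgroup_prod sgH)/sg_sub2. Qed.

Lemma is_subgroup_conj H x y : is_subgroup H -> x \in H -> y \in H ->
  pdom (conj_word x y) /\ pconj x y \in H.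
Proof.
move=> sgH xH yH; have /(subsetP (sub_pnorm sgH)) yN := yH.
by split; [case/pnormP: yN => /(_ x xH) | exact: pnorm_conj yN xH].
Qed.

(** All words over X inherit membership in the domain from H, so closure only has to be checked for
    products of two elements. *)
Lemma is_subgroupP H X : is_subgroup H -> X \subset H ->
  part_prod [::] \in X -> (forall x, x \in X -> pinv x \in X) ->
  (forall x y, x \in X -> y \in X -> part_prod [:: x; y] \in X) ->
  is_subgroup X.
Proof.
move=> sgH /subsetP sXH X1 XV XM.
have dom w : {subset w <= X} -> pdom w.
  by move=> s; apply: (subgroup_dom sgH) => t /s /sXH.
split=> //; first by apply/set0Pn; exists (part_prod [::]).
elim=> [|x w IH] s //; rewrite (@part_prod_cat _ [:: x]); last exact: dom.
rewrite part_prod1; apply: XM; first by rewrite s ?mem_head.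
by apply: IH => t tw; rewrite s // inE tw orbT.
Qed.

Lemma is_subgroupI H X Y : is_subgroup H -> is_subgroup X -> is_subgroup Y ->
  X \subset H -> is_subgroup (X :&: Y).
Proof.
move=> sgH sgX sgY sXH; apply: (is_subgroupP sgH).
- exact: subset_trans (subsetIl _ _) sXH.
- by rewrite inE !is_subgroup1.
- by move=> x /setIP[xX xY]; rewrite inE !subgroup_inv.
- by move=> x y /setIP[xX xY] /setIP[yX yY]; rewrite inE !is_subgroupM.
Qed.

(** By [pconjM], conjugation by g is multiplicative on X; the ambient H supplies the domain for
    words in the image. *)
Lemma conj_is_subgroup H X g : is_subgroup H -> is_subgroup X ->
    conj_set X g \subset H ->
    {in X &, forall x y, pdom (conj_word x g ++ conj_word y g)} ->
  is_subgroup (conj_set X g).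
Proof.
move=> sgH sgX sXgH D; apply: (is_subgroupP sgH) => //.
- by have [_ <-] := pconj1l g; apply/mem_conj_set/is_subgroup1.
- move=> _ /imsetP[x xX ->].
  have [_ <-] := pconj_inv (pdom_prefix (D x x xX xX)).
  exact/mem_conj_set/(subgroup_inv sgX).
- move=> _ _ /imsetP[x xX ->] /imsetP[y yX ->].
  by have [_ <-] := pconjM (D x y xX yX); apply/mem_conj_set/is_subgroupM.
Qed.

End Conjugation.

(** * Transfer between subgroups of L and finite groups *)

Section SubgroupBridge.
Variables (L : finPartialGroupType) (H : {set L}) (sgH : is_subgroup H).
Local Notation gT := (subgroup_type sgH).
Implicit Types (x y : gT) (G : {group gT}) (X : {set L}).

Lemma val_sgJ x y : val (x ^ y) = pconj (val x) (val y).
Proof.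
have D : pdom (conj_word (val x) (val y)).
  by case: (is_subgroup_conj sgH (valP x) (valP y)).
have [_ /= E] := @part_prod_subst L [:: pinv (val y)] [:: val x; val y] [::] D.
by rewrite /pconj E.
Qed.

Lemma val_sg_prod (s : seq gT) :
  val (\prod_(x <- s) x) = part_prod [seq val x | x <- s].
Proof.
elim: s => [|x s IH]; first by rewrite big_nil.
have D : pdom [seq val y | y <- x :: s].
  by apply: (subgroup_dom sgH) => _ /mapP[y _ ->]; apply: valP.
rewrite big_cons /= (@part_prod_cat L [:: val x] _ D) part_prod1 -IH.
by [].
Qed.

Lemma to_subgroup_group_set X : is_subgroup X -> group_set (to_subgroup sgH X).
Proof.
move=> sgX; apply/group_setP; split; first by rewrite inE is_subgroup1.
by move=> x y; rewrite !inE => xX yX; apply: is_subgroupM.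
Qed.

Lemma to_subgroupK X : X \subset H -> val @: to_subgroup sgH X = X.
Proof.
move/subsetP=> sXH; apply/setP=> x; apply/imsetP/idP => [[y]|xX].
  by rewrite inE => yX ->.
by exists (Sub x (sXH x xX) : gT); rewrite ?inE SubK.
Qed.

Lemma card_to_subgroup X : X \subset H -> #|to_subgroup sgH X| = #|X|.
Proof. by move/to_subgroupK=> {2}<-; rewrite card_imset //; apply: val_inj. Qed.

Lemma to_subgroup_sub X Y : X \subset H ->
  (to_subgroup sgH X \subset to_subgroup sgH Y) = (X \subset Y).
Proof.
move=> sXH; apply/subsetP/subsetP => s x.
  by move=> xX; have := s (Sub x (subsetP sXH x xX)); rewrite !inE SubK; apply.
by rewrite !inE; apply: s.
Qed.

Lemma val_group_sub G : val @: G \subset H.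
Proof. by apply/subsetP=> _ /imsetP[x _ ->]; apply: valP. Qed.

Lemma card_val_group G : #|val @: G| = #|G|.
Proof. by rewrite card_imset //; apply: val_inj. Qed.

Lemma val_group_is_subgroup G : is_subgroup (val @: G).
Proof.
apply: (is_subgroupP sgH (val_group_sub G)).
- by apply/imsetP; exists (1 : gT).
- by move=> _ /imsetP[x xG ->]; apply/imsetP; exists x^-1; rewrite ?groupV.
- move=> _ _ /imsetP[x xG ->] /imsetP[y yG ->].
  by apply/imsetP; exists (x * y); rewrite ?groupM.
Qed.

End SubgroupBridge.

(** * Growth of normalizers in p-subgroups *)

Section NormalizersGrow.
Variables (L : finPartialGroupType) (p : nat).
Implicit Types (P T : {set L}).

Lemma psubgroup_norm_grows T P : is_psubgroup p T -> is_subgroup P ->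
  P \proper T -> P \proper T :&: pnorm P.
Proof.
move=> [sgT pT] sgP /[dup] ltPT /proper_sub sPT.
pose G := [set: subgroup_type sgT]%G.
pose Q := Group (to_subgroup_group_set sgT sgP).
have pG : p.-group G by rewrite /pgroup cardsT card_sig.
have ltQ : Q \proper G.
  by rewrite properEcard subsetT cardsT card_sig card_to_subgroup ?proper_card.
have /proper_subn := nilpotent_proper_norm (pgroup_nil pG) ltQ.
rewrite properE subsetI sPT sub_pnorm //=.
apply: contra => sNP; apply/subsetP=> x /setIP[xG xN].
rewrite inE; apply: (subsetP sNP); apply/setIP; split; first exact: valP.
apply: pnorm_of => y yP.
  by case: (is_subgroup_conj sgT (subsetP sPT y yP) (valP x)).
have yE : y = val (Sub y (subsetP sPT y yP) : subgroup_type sgT) by [].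
rewrite yE -val_sgJ.
have : (Sub y (subsetP sPT y yP) : subgroup_type sgT) \in to_subgroup sgT P.
  by rewrite inE.
by rewrite -(memJ_norm _ xN) inE.
Qed.

End NormalizersGrow.

(** * Chains of objects along a word *)

Section Via.
Variables (L : finPartialGroupType) (p : nat).
Variables (Delta : {set {set L}}) (S : {set L}) (loc : locality p Delta S).
Implicit Types (a b g h x : L) (u v w : seq L) (A P X Y : {set L}).

Local Notation one := (part_prod [::] : L).
Local Notation conjw := (foldl (@conj_set L)).

Lemma Delta_subgroup X : X \in Delta -> is_subgroup X.
Proof. by case/(loc_Delta loc). Qed.

Lemma Delta_sub X : X \in Delta -> X \subset S.
Proof. by case/(loc_Delta loc). Qed.

Lemma locS_subgroup : is_subgroup S. Proof. by case: (loc_S loc). Qed.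

Lemma conj_set1 X : conj_defined X one /\ conj_set X one = X.
Proof.
split; first by apply/forall_inP=> x _; case: (pconj1r x).
rewrite -[RHS]imset_id; apply: eq_imset => x; by case: (pconj1r x).
Qed.

(** This is (O2) for conjugation by the unit, with Y = S. *)
Lemma Delta_over X Z :
  X \in Delta -> is_subgroup Z -> X \subset Z -> Z \subset S -> Z \in Delta.
Proof.
move=> XD sgZ sXZ sZS; have [D1 E1] := conj_set1 X.
apply: (loc_O2 loc XD (loc_SDelta loc) D1); rewrite ?E1 //.
  exact: Delta_subgroup.
exact: Delta_sub.
Qed.

Lemma Delta_conj X g : X \in Delta -> conj_defined X g ->
    is_subgroup (conj_set X g) -> conj_set X g \subset S ->
  conj_set X g \in Delta.
Proof.
by move=> XD D sg s; apply: (loc_O2 loc XD (loc_SDelta loc) D).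
Qed.

(* [via X w]: the chain of (O1) for w that starts at X; it is determined by X. *)
Fixpoint via X w : bool :=
  (X \in Delta) &&
  (if w is g :: w' then conj_defined X g && via (conj_set X g) w' else true).

Lemma via_pdom X w : via X w -> pdom w.
Proof.
move=> vXw; apply/(loc_O1 loc).
suff [F [_ F1 F2]] : exists F : nat -> {set L},
    [/\ F 0 = X, forall i, i <= size w -> F i \in Delta
      & forall i, i < size w -> conj_defined (F i) (nth one w i) /\
          conj_set (F i) (nth one w i) = F i.+1] by exists F.
elim: w X vXw => [|g w IH] X /=.
  by rewrite andbT => XD; exists (fun=> X).
case/and3P=> XD Dg /IH[F [F0 F1 F2]].
exists (fun i => if i is j.+1 then F j else X); split=> //.
  by case=> // i; apply: F1.
by case=> [|i]; [rewrite F0 | apply: F2].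
Qed.

Lemma pdom_via w : pdom w -> exists X, via X w.
Proof.
move=> /(loc_O1 loc)[F [F1 F2]]; exists (F 0).
elim: w F F1 F2 => [|g w IH] F F1 F2 /=; first by rewrite F1.
rewrite F1 //=; have [/= -> ->] := F2 0 (ltn0Sn _).
by apply: (IH (fun i => F i.+1)) => i; [apply: (F1 i.+1) | apply: (F2 i.+1)].
Qed.

Lemma via_Delta X w : via X w -> X \in Delta.
Proof. by case: w => [|g w] /= /andP[]. Qed.

Lemma via_cat X u v : via X (u ++ v) = via X u && via (conjw X u) v.
Proof.
elim: u X => [|g u IH] X /=; last by rewrite IH !andbA.
by case v1: (via X v); rewrite ?andbF // (via_Delta v1).
Qed.

Lemma via_last X w : via X w -> conjw X w \in Delta.
Proof. by rewrite -{1}(cats0 w) via_cat => /andP[_] /=; rewrite andbT. Qed.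

(** Recording the end point lets chains be composed by [link_cat], which is how longer words are
    shown to lie in the domain. *)
Definition link X w Y := via X w /\ conjw X w = Y.

Lemma link_cat X Y Z u v : link X u Y -> link Y v Z -> link X (u ++ v) Z.
Proof. by case=> vu <- [vv <-]; rewrite /link via_cat vu foldl_cat. Qed.

Lemma link_pdom X w Y : link X w Y -> pdom w.
Proof. by case=> /via_pdom. Qed.

Lemma via1P X g : reflect
  [/\ X \in Delta, conj_defined X g & conj_set X g \in Delta] (via X [:: g]).
Proof. by rewrite /= andbT; apply: and3P. Qed.

Lemma via_norm X a : X \in Delta -> a \in pnorm X ->
  via X [:: a] /\ conj_set X a = X.
Proof.
move=> XD; rewrite inE => /andP[D /eqP E]; split=> //.
by apply/via1P; rewrite E.
Qed.

Lemma via_winv X w : via X w ->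
  via (conjw X w) (winv w) /\ conjw (conjw X w) (winv w) = X.
Proof.
elim: w X => [|g w IH] X //=.
case/and3P=> XD Dg /IH[v1 E1]; have [D2 E2] := conj_setK Dg.
rewrite winv_cons -cats1 via_cat foldl_cat v1 E1; split=> //=.
by rewrite D2 E2 XD -{1}E1 (via_last v1).
Qed.

Lemma link_winv X w Y : link X w Y -> link Y (winv w) X.
Proof. by case=> + <-; apply: via_winv. Qed.

Lemma link_inv X g Y : link X [:: g] Y -> link Y [:: pinv g] X.
Proof. exact: (@link_winv X [:: g]). Qed.

Lemma conjwE X w : conjw X w = [set foldl (@pconj L) x w | x in X].
Proof.
elim: w X => [|g w IH] X /=; first by rewrite imset_id.
by rewrite IH /conj_set -imset_comp.
Qed.

(** The chain returns from X^w to X along the inverse word, a fixes X, and w leads out again. So w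
    conjugates all of N_L(X), not only X. *)
Lemma via_conj X w a : via X w -> a \in pnorm X ->
  via (conjw X w) (winv w ++ a :: w) /\
  conjw (conjw X w) (winv w ++ a :: w) = conjw X w.
Proof.
move=> vX aN; have [v1 E1] := via_winv vX.
have [/andP[XD /andP[Da _]] Ea] := via_norm (via_Delta vX) aN.
by rewrite via_cat foldl_cat E1 v1 /= XD Da Ea.
Qed.

Lemma via_pconj X w a : via X w -> a \in pnorm X ->
  pdom (conj_word a (part_prod w)) /\
  pconj a (part_prod w) = foldl (@pconj L) a w.
Proof.
move=> vX aN; have [v1 _] := via_conj vX aN.
exact: pconj_prod (via_pdom vX) (via_pdom v1).
Qed.

(** Elements of X lie in N_L(X), so [via_pconj] identifies conjugation by the product with iterated
    conjugation along w. *)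
Lemma via_prod X w : via X w ->
  via X [:: part_prod w] /\ conj_set X (part_prod w) = conjw X w.
Proof.
move=> vX; have XD := via_Delta vX.
have sXN := subsetP (sub_pnorm (Delta_subgroup XD)).
have E : conj_set X (part_prod w) = conjw X w.
  by rewrite conjwE; apply: eq_in_imset => x /sXN/(via_pconj vX)[].
split=> //; apply/via1P; rewrite E XD via_last //; split=> //.
by apply/forall_inP=> x /sXN/(via_pconj vX)[].
Qed.

Lemma via_pnorm X w a : via X w -> a \in pnorm X ->
  pconj a (part_prod w) \in pnorm (conjw X w).
Proof.
move=> vX aN; have [v1 E1] := via_conj vX aN.
have [_ ->] := via_pconj vX aN; rewrite -foldl_pconj ?(via_pdom v1) //.
by have [/via1P[_ D _] E] := via_prod v1; rewrite inE D E E1 /=.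
Qed.

Lemma via_pconjM X g a b : via X [:: g] -> a \in pnorm X -> b \in pnorm X ->
  pdom (conj_word a g ++ conj_word b g).
Proof.
move=> vX aN bN.
have [v1 E1] := via_conj vX aN; have [v2 _] := via_conj vX bN.
by apply: (@via_pdom (conjw X [:: g])); rewrite via_cat v1 E1.
Qed.

(** Conjugation by g is a homomorphism from N_L(X) to N_L(X^g): the conjugation words of two
    elements of N_L(X) are loops at X^g, which can be run one after the other. *)
Lemma conj_norm_subgroup X g A : via X [:: g] -> is_subgroup A ->
    A \subset pnorm X ->
  [/\ conj_defined A g, is_subgroup (conj_set A g)
    & conj_set A g \subset pnorm (conj_set X g)].
Proof.
move=> vX sgA /subsetP sAN; have [XD DX XgD] := via1P _ _ vX.
have sAg : conj_set A g \subset pnorm (conj_set X g).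
  apply/subsetP=> _ /imsetP[a /sAN aN ->].
  by have := via_pnorm vX aN; rewrite part_prod1.
split=> //.
  by apply/forall_inP=> a /sAN/(via_pconj vX); rewrite part_prod1; case.
apply: (conj_is_subgroup (pnorm_subgroup loc XgD)) => // a b /sAN aN /sAN bN.
exact: via_pconjM vX aN bN.
Qed.

Lemma via_S X a : X \in Delta -> a \in S -> via X [:: a].
Proof.
move=> XD aS; have sXS := subsetP (Delta_sub XD).
have D : conj_defined X a.
  by apply/forall_inP=> x /sXS xS; case: (is_subgroup_conj locS_subgroup xS aS).
have s : conj_set X a \subset S.
  apply/subsetP=> _ /imsetP[x /sXS xS ->].
  by case: (is_subgroup_conj locS_subgroup xS aS).
apply/via1P; split=> //; apply: Delta_conj => //.
apply: (conj_is_subgroup locS_subgroup) => //; first exact: Delta_subgroup.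
move=> x y /sXS xS /sXS yS; apply: (subgroup_dom locS_subgroup) => t.
have aVS := subgroup_inv locS_subgroup aS.
by rewrite !inE => /or4P[|||/or3P[]] /eqP->.
Qed.

(* If b = a^g is in S then g = a^-1 g b, so conjugation by g is also visible
   on X^a: it is the composite X^a -> X -> X^g -> (X^g)^b. *)
Lemma via_conj_in X g a : via X [:: g] -> a \in S -> conj_in S a g ->
  via (conj_set X a) [:: g].
Proof.
move=> vX aS /andP[Da bS]; set b := pconj a g in bS.
have [XD DX XgD] := via1P _ _ vX; have vXa := via_S XD aS.
have [v2 _] : link (conj_set X a) [:: pinv a; g; b] (conj_set (conj_set X g) b).
  apply: (link_cat (u := [:: _])); first exact: (@link_inv X).
  apply: (link_cat (u := [:: _]) (Y := conj_set X g)); first by [].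
  by split=> //; apply: via_S.
suff E : part_prod [:: pinv a; g; b] = g by rewrite -E; case: (via_prod v2).
(* This word evaluates both to the product of g and b and to the product of a and g. *)
have D3 : pdom [:: g; pinv g; a; g].
  have := (part_prod_inv Da).1; rewrite -/(winv _) winv_conj_word.
  exact: (@pdom_suffix _ [:: pinv g; pinv a]).
have [D4 /= E4] := @part_prod_subst L [:: g] [:: pinv g; a; g] [::] D3.
have [D5 /= E5] := @part_prod_subst L [::] [:: g; pinv g; a] [:: g] D3.
have Egb : part_prod [:: g; b] = part_prod [:: a; g].
  by rewrite -E4 E5 part_prodKl // (@pdom_prefix _ _ [:: g]).
have [_ /= ->] := @part_prod_subst L [:: pinv a] [:: g; b] [::] (via_pdom v2).
have D6 : pdom [:: pinv a; a; g].
  have := (part_prod_inv (pdom_suffix (u := [:: pinv g]) Da)).1.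
  rewrite -/(winv _) /winv /rev /=.
  exact: (@pdom_suffix _ [:: pinv g]).
have [_ /= E6] := @part_prod_subst L [:: pinv a] [:: a; g] [::] D6.
by rewrite Egb -E6 part_prodVKl.
Qed.

(** * The subgroups S_g and S_w *)

Lemma S_eltP g a : reflect (a \in S /\ conj_in S a g) (a \in S_elt S g).
Proof. by rewrite inE; apply: andP. Qed.

Lemma S_elt_sub g : S_elt S g \subset S.
Proof. by apply/subsetP=> a /S_eltP[]. Qed.

(** Start from any X with a chain for g. By [via_conj_in], chains for g also start at X^a and
    X^(ab), so the six letters run through X^g, X, X^a, X^(ag), X^a, X^(ab), X^(abg). *)
Lemma S_elt_pconjM g a b : a \in S_elt S g -> b \in S_elt S g ->
  pdom (conj_word a g ++ conj_word b g).
Proof.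
case/S_eltP=> aS ag /S_eltP[bS bg].
have [X vX] := pdom_via (pdom1 g).
have vXa := via_conj_in vX aS ag; have vXab := via_conj_in vXa bS bg.
have XaS : link X [:: a] (conj_set X a).
  by split; rewrite ?via_S ?(via_Delta vX).
have Xab : link (conj_set X a) [:: b] (conj_set (conj_set X a) b).
  by split; rewrite ?via_S ?(via_Delta vXa).
have gl Y : via Y [:: g] -> link Y [:: g] (conj_set Y g) by [].
apply: link_pdom; apply: (link_cat (u := [:: _; _; _])).
  apply: (link_cat (u := [:: _])); first exact: link_inv (gl _ vX).
  apply: (link_cat (u := [:: _]) XaS); exact: gl.
apply: (link_cat (u := [:: _])); first exact: link_inv (gl _ vXa).
apply: (link_cat (u := [:: _]) Xab); exact: gl.
Qed.

Lemma S_elt_subgroup g : is_subgroup (S_elt S g).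
Proof.
apply: (is_subgroupP locS_subgroup (S_elt_sub g)).
- have [D1 E1] := pconj1l g; apply/S_eltP.
  by rewrite /conj_in D1 E1 is_subgroup1 //; exact: locS_subgroup.
- move=> a /S_eltP[aS /andP[D agS]]; have [D' E'] := pconj_inv D.
  apply/S_eltP; rewrite /conj_in D' E'.
  by rewrite !(subgroup_inv locS_subgroup).
- move=> a b aX bX; have [D E] := pconjM (S_elt_pconjM aX bX).
  case/S_eltP: aX => aS /andP[_ agS]; case/S_eltP: bX => bS /andP[_ bgS].
  by apply/S_eltP; rewrite /conj_in D E !(is_subgroupM locS_subgroup).
Qed.

Lemma S_eltSP X g : X \subset S ->
  reflect (conj_defined X g /\ conj_set X g \subset S) (X \subset S_elt S g).
Proof.
move=> /subsetP sXS.
apply: (iffP subsetP) => [s | [/forall_inP D /subsetP s] x xX].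
  split; first by apply/forall_inP=> x /s/S_eltP[_ /andP[]].
  by apply/subsetP=> _ /imsetP[x /s/S_eltP[_ /andP[_ xgS]] ->].
by apply/S_eltP; rewrite /conj_in sXS // D // s ?mem_conj_set.
Qed.

(** For an object X inside S_g, the conjugate lies in S and is a subgroup by [S_elt_pconjM], hence
    is an object by (O2). *)
Lemma via1E X g : via X [:: g] = (X \in Delta) && (X \subset S_elt S g).
Proof.
apply/idP/idP => [/via1P[XD D XgD]|/andP[XD sX]].
  by rewrite XD; apply/(S_eltSP _ (Delta_sub XD)); rewrite D Delta_sub.
have [D s] := S_eltSP g (Delta_sub XD) sX; apply/via1P; split=> //.
apply: Delta_conj => //.
apply: (conj_is_subgroup locS_subgroup) => //; first exact: Delta_subgroup.
by move=> x y /(subsetP sX) xX /(subsetP sX); apply: S_elt_pconjM.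
Qed.

Lemma S_elt_Delta g : S_elt S g \in Delta.
Proof.
have [X] := pdom_via (pdom1 g); rewrite via1E => /andP[XD sX].
exact: Delta_over XD (S_elt_subgroup g) sX (S_elt_sub g).
Qed.

Lemma via_S_elt g : via (S_elt S g) [:: g].
Proof. by rewrite via1E S_elt_Delta /=. Qed.

Lemma S_word_cons g w a :
  (a \in S_word S (g :: w)) = (a \in S_elt S g) && (pconj a g \in S_word S w).
Proof.
rewrite !inE /=; case: (a \in S) => //=; rewrite /conj_in.
by case: (pdom _) => //=; case: (_ \in S).
Qed.

Lemma S_word_sub w : S_word S w \subset S.
Proof. by apply/subsetP=> a; rewrite inE => /andP[]. Qed.

Lemma S_word_subgroup w : is_subgroup (S_word S w).
Proof.
apply: (is_subgroupP locS_subgroup (S_word_sub w)).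
- elim: w => [|g w IH].
    by rewrite inE /= is_subgroup1 //; exact: locS_subgroup.
  by rewrite S_word_cons (pconj1l g).2 IH (is_subgroup1 (S_elt_subgroup g)).
- elim: w => [|g w IH] x.
    by rewrite !inE !andbT; apply: subgroup_inv locS_subgroup _.
  rewrite !S_word_cons => /andP[xg xw].
  rewrite (subgroup_inv (S_elt_subgroup g)) //.
  by case/S_eltP: xg => _ /andP[/pconj_inv[_ ->] _]; apply: IH.
- elim: w => [|g w IH] x y.
    by rewrite !inE !andbT; apply: is_subgroupM locS_subgroup.
  rewrite !S_word_cons => /andP[xg xw] /andP[yg yw].
  rewrite (is_subgroupM (S_elt_subgroup g)) //=.
  by have [_ ->] := pconjM (S_elt_pconjM xg yg); apply: IH.
Qed.

Lemma viaE X w : via X w = (X \in Delta) && (X \subset S_word S w).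
Proof.
elim: w X => [|g w IH] X.
  case XD: (X \in Delta); rewrite /= ?XD //=; apply/esym/subsetP => x xX.
  by rewrite inE (subsetP (Delta_sub XD)).
rewrite -cat1s via_cat via1E; case XD: (X \in Delta) => //=.
apply/andP/subsetP => [[sX]|sX].
  rewrite IH => /andP[_ sXg] x xX.
  by rewrite S_word_cons (subsetP sX) // (subsetP sXg) ?mem_conj_set.
have sXg : X \subset S_elt S g.
  by apply/subsetP=> x /sX; rewrite S_word_cons => /andP[].
split=> //; rewrite IH; have /via1P[_ _ ->] : via X [:: g] by rewrite via1E XD.
by apply/subsetP=> _ /imsetP[x /sX + ->]; rewrite S_word_cons => /andP[].
Qed.

(** Every start of a chain for w lies in S_w, so S_w is an object by (O2) and is itself a start.
    This turns (O1) into a condition on one subgroup. *)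
Lemma pdom_S_word w : pdom w = (S_word S w \in Delta).
Proof.
apply/idP/idP => [/pdom_via[X]|D]; last first.
  by apply: (@via_pdom (S_word S w)); rewrite viaE D /=.
rewrite viaE => /andP[XD sX].
exact: Delta_over XD (S_word_subgroup w) sX (S_word_sub w).
Qed.

Lemma via_S_word w : pdom w -> via (S_word S w) w.
Proof. by rewrite viaE pdom_S_word => -> /=. Qed.

Lemma S_word_prod w a : pdom w -> a \in S_word S w ->
  a \in S_elt S (part_prod w) /\ pconj a (part_prod w) = foldl (@pconj L) a w.
Proof.
move=> /via_S_word v aS; have vD := via_Delta v.
have [+ _] := via_prod v; rewrite via1E => /andP[_ /subsetP->] //.
have [] // := @via_pconj _ _ a v.
exact: (subsetP (sub_pnorm (Delta_subgroup vD))).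
Qed.

(** For a fixed v, the left side depends on u only through S_u and the product of u; this allows
    subwords to be replaced. *)
Lemma S_word_cat u v a : pdom u ->
  (a \in S_word S (u ++ v)) =
  (a \in S_word S u) && (pconj a (part_prod u) \in S_word S v).
Proof.
move=> Du; case au: (a \in S_word S u); last first.
  apply/negP=> auv; move/negP: au; apply.
  elim: u {Du} a auv => [|g u IH] a; first by rewrite !inE => /andP[->].
  by rewrite cat_cons !S_word_cons => /andP[-> /IH].
have [_ ->] := S_word_prod Du au; move: au {Du}.
elim: u a => [|g u IH] a //=.
by rewrite !S_word_cons => /andP[-> /IH].
Qed.

End Via.

(** * Fully normalized objects *)

Section FullyNormalized.
Variables (L : finPartialGroupType) (p : nat).
Variables (Delta : {set {set L}}) (S : {set L}) (loc : locality p Delta S).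
Implicit Types (a b g h x : L) (u v w : seq L) (A H P R X Y : {set L}).

Local Notation N PD := (pnorm_subgroup loc PD).
Local Notation via := (via Delta).

Definition sylow_in_norm R (RD : R \in Delta) :=
  p.-Sylow([set: subgroup_type (N RD)]) (to_subgroup (N RD) S).

(** The Sylow form of the notion, which is the first condition for R to be essential. The proof [RD]
    is quantified because the group structure on N_L(R) is built from it. *)
Definition fully_normalized R := exists RD : R \in Delta, sylow_in_norm RD.

Lemma psubgroup_sub A X : is_psubgroup p X -> is_subgroup A -> A \subset X ->
  is_psubgroup p A.
Proof.
move=> [sgX pX] sgA sAX; split=> //.
rewrite -(card_to_subgroup sgX sAX).
rewrite -[to_subgroup sgX A]/(gval (Group (to_subgroup_group_set sgX sgA))).
apply: pnat_dvd (cardSg (subsetT _)) _.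
by rewrite cardsT card_sig.
Qed.

Lemma val_pgroup H (sgH : is_subgroup H) (T : {group subgroup_type sgH}) :
  p.-group T -> is_psubgroup p (val @: T).
Proof.
by move=> pT; split; [apply: val_group_is_subgroup | rewrite card_val_group].
Qed.

Lemma to_subgroup_pgroup H (sgH : is_subgroup H) A (sgA : is_subgroup A) :
  A \subset H -> is_psubgroup p A ->
  p.-group (Group (to_subgroup_group_set sgH sgA)).
Proof. by move=> sAH [_ pA]; rewrite /pgroup /= card_to_subgroup. Qed.

Lemma sub_fully_normalized R A : fully_normalized R -> is_psubgroup p A ->
  A \subset pnorm R -> exists2 x, x \in pnorm R &
    forall a, a \in A -> pconj a x \in S.
Proof.
move=> [RD sylR] pA sAN; have sgA := proj1 pA.
pose T := Group (to_subgroup_group_set (N RD) (locS_subgroup loc)).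
pose B := Group (to_subgroup_group_set (N RD) sgA).
have pB : p.-group B by apply: to_subgroup_pgroup.
have [x _ sBT] := Sylow_Jsub (P := T) sylR (subsetT B) pB.
exists (val x) => [|a aA]; first exact: valP.
have := memJ_conjg B x (Sub a (subsetP sAN a aA)).
by rewrite [RHS]inE SubK aA => /(subsetP sBT); rewrite inE val_sgJ.
Qed.

(** First h carries A into N_L(P^h); Sylow's theorem there gives x moving the image into S. As x
    normalizes P^h, the product k of h and x still carries P to P^h. *)
Lemma conj_into_S P h A : via P [:: h] -> fully_normalized (conj_set P h) ->
    is_psubgroup p A -> A \subset pnorm P ->
  exists k, [/\ via P [:: k], conj_set P k = conj_set P h,
    conj_defined A k & conj_set A k \subset S].
Proof.
move=> vP fnR [sgA pA] sAN.
have [DA sgAh sAhN] := conj_norm_subgroup loc vP sgA sAN.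
have pAh : is_psubgroup p (conj_set A h) by split; rewrite ?card_conj_set.
have [x xN xS] := sub_fully_normalized fnR pAh sAhN.
have [RD _] := fnR; have [vR ER] := via_norm RD xN.
have v2 : via P ([:: h] ++ [:: x]) by rewrite via_cat vP.
have [v3 E3] := via_prod loc v2.
have [DAk sgAk sAkN] := conj_norm_subgroup loc v3 sgA sAN.
exists (part_prod [:: h; x]); split=> //; first by rewrite E3 /= ER.
apply/subsetP=> _ /imsetP[a aA ->].
have [_ /= ->] := via_pconj loc v2 (subsetP sAN a aA).
exact/xS/mem_conj_set.
Qed.

(** A Sylow p-subgroup of N_L(S) containing S is a p-subgroup of L, hence equals S by the maximality
    (L). *)
Lemma fully_normalized_S : fully_normalized S.
Proof.
have SD := loc_SDelta loc; exists SD; rewrite /sylow_in_norm.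
have sSN := sub_pnorm (locS_subgroup loc).
pose T := Group (to_subgroup_group_set (N SD) (locS_subgroup loc)).
have pT : p.-group T by apply: to_subgroup_pgroup => //; exact: (loc_S loc).
have [Q sylQ sTQ] := Sylow_superset (subsetT T) pT.
rewrite -[to_subgroup _ _]/(gval T); suff -> : T = Q by [].
apply/val_inj/setP=> x; apply/idP/idP => [/(subsetP sTQ) //|xQ] /=.
have sSQ : S \subset val @: Q.
  apply: subset_trans (imsetS val sTQ).
  by have /eqP := to_subgroupK (N SD) sSN; rewrite eqEsubset => /andP[].
have QS := loc_L loc (val_pgroup (pHall_pgroup sylQ)) sSQ.
by rewrite inE; have : val x \in val @: Q by [exact: imset_f]; rewrite QS.
Qed.

Lemma card_via P h : via P [:: h] -> #|conj_set P h| = #|P|.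
Proof. by move=> /via1P[_ D _]; rewrite card_conj_set. Qed.

Lemma proper_S P : P \in Delta -> P != S -> P \proper S.
Proof. by move=> PD nPS; rewrite properEneq nPS (Delta_sub loc). Qed.

Lemma norm_S_Delta P : P \in Delta -> S :&: pnorm P \in Delta.
Proof.
move=> PD; have sgP := Delta_subgroup loc PD.
apply: (Delta_over loc PD); last exact: subsetIl.
  apply: (is_subgroupI (locS_subgroup loc) (locS_subgroup loc)) => //.
  exact: pnorm_subgroup loc PD.
by rewrite subsetI sub_pnorm // (Delta_sub loc PD).
Qed.

(* A conjugate R of P with |N_S(R)| maximal is fully normalized: otherwise a
   p-subgroup of N_L(R) properly containing M = N_S(R) and normalizing it could
   be moved into S by an element defined on M, as M has a fully normalized
   conjugate by induction. *)
Lemma exists_fully_normalized P : P \in Delta ->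
  exists2 h, via P [:: h] & fully_normalized (conj_set P h).
Proof.
(* The induction runs towards larger subgroups, so that it covers M, which properly contains the
   conjugate R of P. *)
have [n] := ubnP (#|S| - #|P|); elim: n P => // n IH P /ltnSE lePn PD.
have v1 X : X \in Delta -> via X [:: part_prod [::]].
  by move=> XD; have [D1 E1] := conj_set1 X; apply/via1P; rewrite D1 E1.
have [PS|nPS] := eqVneq P S.
  exists (part_prod [::]); first exact: v1.
  by rewrite (conj_set1 P).2 PS; apply: fully_normalized_S.
pose F h := #|S :&: pnorm (conj_set P h)|.
pose h := [arg max_(h > part_prod [::] | via P [:: h]) F h].
have [vh maxh] : via P [:: h] /\ forall k, via P [:: k] -> F k <= F h.
  by rewrite /h; case: arg_maxnP => //; apply: v1.
exists h => //; have /via1P[_ Dh RD] := vh.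
move: (card_via vh) (via_last (w := [:: h]) vh) => /=.
set R := conj_set P h in RD *; rewrite /F -/R in maxh => cR _.
have nRS : R != S by apply: contra_neq nPS => RS; apply/eqP;
  rewrite eqEcard (Delta_sub loc PD) -cR RS /=.
exists RD; pose M := S :&: pnorm R.
have MD : M \in Delta by apply: norm_S_Delta.
have sgM := Delta_subgroup loc MD; have sgN := N RD.
pose T := Group (to_subgroup_group_set (N RD) sgM).
have sMN : M \subset pnorm R by apply: subsetIr.
have TE : to_subgroup (N RD) S = T.
  by apply/setP=> x; rewrite [LHS]inE [RHS]inE [RHS]in_setI (valP x) andbT.
have pM : is_psubgroup p M := psubgroup_sub (loc_S loc) sgM (subsetIl _ _).
have pT : p.-group T by apply: to_subgroup_pgroup.
have [Q sylQ sTQ] := Sylow_superset (subsetT T) pT.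
rewrite /sylow_in_norm TE; have [->|nTQ] := eqVneq T Q; first by [].
have pQ := val_pgroup (pHall_pgroup sylQ).
have ltMQ : M \proper val @: Q.
  rewrite properEcard -{1}(to_subgroupK (N RD) sMN) imsetS //= card_val_group.
  rewrite -(card_to_subgroup (N RD) sMN) -[to_subgroup _ M]/(gval T).
  apply: proper_card; rewrite properEneq sTQ andbT.
  by apply: contra_neq nTQ => /val_inj.
have := psubgroup_norm_grows pQ sgM ltMQ; set A := _ :&: _ => ltMA.
have sgA : is_subgroup A.
  apply: (is_subgroupI sgN) (val_group_sub _).
    exact: val_group_is_subgroup.
  exact: pnorm_subgroup loc MD.
have sAQ : A \subset val @: Q by apply: subsetIl.
have sAN : A \subset pnorm R := subset_trans sAQ (val_group_sub _).
have pA : is_psubgroup p A := psubgroup_sub pQ sgA sAQ.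
have ltRM : R \proper M.
  apply: psubgroup_norm_grows (loc_S loc) (Delta_subgroup loc RD) _.
  exact: proper_S RD nRS.
have [|k0 vk0 fnM] := IH M _ MD.
  apply: leq_trans lePn; rewrite ltn_sub2l //; last by rewrite -cR proper_card.
  by rewrite -cR; apply/proper_card/proper_S.
have [k [vk Ek DAk sAkS]] := conj_into_S vk0 fnM pA (subsetIr _ _).
have sRM := proper_sub ltRM.
(* Since R lies in M, k also conjugates R, to another conjugate of P. Then A^k lies in N_S(R^k), and
   |A| > |M| contradicts the choice of h. *)
have vRk : via R [:: k].
  rewrite (via1E loc) RD; move: vk; rewrite (via1E loc) => /andP[_].
  exact: subset_trans.
have v2 : via P ([:: h] ++ [:: k]) by rewrite via_cat vh.
have [v3 E3] := via_prod loc v2; have := maxh _ v3; rewrite /F E3 /= -/R.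
have [DA' sgAk sAkN] := conj_norm_subgroup loc vRk sgA sAN.
have : #|conj_set A k| <= #|S :&: pnorm (conj_set R k)|.
  by apply: subset_leq_card; rewrite subsetI sAkS.
rewrite card_conj_set // => le1 /(leq_trans le1).
by rewrite leqNgt (proper_card ltMA).
Qed.

End FullyNormalized.

(** * A strongly p-embedded subgroup from Sylow intersections *)

Section StronglyEmbedded.
Variables (gT : finGroupType) (p : nat) (G T R : {group gT}).
Hypotheses (p_pr : prime p) (sylT : p.-Sylow(G) T) (nsRG : R <| G).

(** [T :&: T :^ y^-1] consists of the t in T with t ^ y in T. For T = N_S(R) inside N_L(R) it is the
    part of S_y that normalizes R. *)
Definition overlap := [set y in G | R \proper T :&: T :^ y^-1].

(** Let H be generated by the overlap and let p divide the order of the intersection of H/R with its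
    conjugate by y. Then some p-subgroup U > R has both U and U^(y^-1) in H. Sylow's theorem in H
    moves these into T by elements a and b of H, and a^-1 y^-1 b carries U^a into T. It thus lies in
    the overlap, hence in H, and so does y. *)
Lemma overlap_strongly_embedded : R \proper T -> <<overlap>> \proper G ->
  strongly_embedded p (G / R) (<<overlap>> / R).
Proof.
move=> ltRT ltHG; set H := <<overlap>>%G in ltHG *; have sHG := proper_sub ltHG.
have [sTG pT _] := and3P sylT; have [sRG nRG] := andP nsRG.
have sTH : T \subset H.
  apply/subsetP=> y yT; apply: mem_gen; rewrite inE (subsetP sTG) //=.
  by rewrite conjGid ?groupV // setIid.
have sRH := subset_trans (proper_sub ltRT) sTH.
have nsRH : R <| H by apply: normalS sRH sHG nsRG.
have sylTH : p.-Sylow(H) T by apply: pHall_subl sTH sHG sylT.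
(* A Sylow subgroup U of K contains the normal p-subgroup R, and U = R would make the order of K / R
   prime to p. *)
have pdvd (K : {group gT}) :
    R \subset K -> K \subset G -> p %| #|K / R| ->
  exists2 U : {group gT}, R \proper U & U \subset K /\ p.-group U.
  move=> sRK sKG pK; have nsRK : R <| K by apply: normalS nsRG.
  have [U sylU] := Sylow_exists p K; have [sUK pU p'U] := and3P sylU.
  have sRU : R \subset U.
    apply: subset_trans (pcore_sub_Hall sylU); apply: pcore_max nsRK.
    exact: pgroupS (proper_sub ltRT) pT.
  exists U => //; rewrite properEneq sRU andbT; apply/eqP => RU.
  move: pK; rewrite card_quotient ?normal_norm // RU.
  by apply/negP; rewrite -p'natE.
split.
- rewrite properEneq quotientS // andbT.
  apply: contraTneq ltHG => /(congr1 (fun A : {set _} => coset R @*^-1 A)).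
  by rewrite !quotientGK // => ->; rewrite properxx.
- have nsRT : R <| T by apply: normalS nsRG => //; apply: proper_sub.
  have /(pgroup_pdiv (quotient_pgroup R pT)) [_ pTR _] : T / R != 1.
    by rewrite quotient_neq1.
  exact: dvdn_trans pTR (cardSg (quotientS _ sTH)).
move=> ybar /setDP[/morphimP[y yN yG ->] yH]; apply: contra yH => pK.
apply: mem_quotient.
have nRy : R :^ y = R by apply: normP.
rewrite -quotientJ // -quotientGI //= -/H in pK.
have [||U ltRU [sUK pU]] := pdvd (H :&: H :^ y)%G _ _ pK.
- by rewrite subsetI sRH -{1}nRy conjSg.
- exact: subset_trans (subsetIl _ _) sHG.
move: sUK; rewrite subsetI => /andP[sUH sUHy].
have [a aH sUaT] := Sylow_Jsub sylTH sUH pU.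
have sUyH : U :^ y^-1 \subset H by rewrite sub_conjgV.
have pUy : p.-group (U :^ y^-1) by rewrite pgroupJ.
have [b bH sUbT] := Sylow_Jsub sylTH sUyH pUy.
have aG := subsetP sHG a aH; have bG := subsetP sHG b bH.
have zX : a^-1 * y^-1 * b \in overlap.
  rewrite inE !groupM ?groupV //=.
  have nRa : R :^ a = R by apply/normP/(subsetP nRG).
  rewrite -nRa (@proper_sub_trans _ _ (U :^ a)) ?properJ //.
  rewrite subsetI sUaT -sub_conjg -!conjsgM.
  by rewrite !mulgA mulgV mul1g conjsgM.
have := mem_gen zX; rewrite -/H groupMr // groupMl ?groupV //.
Qed.

End StronglyEmbedded.

(** * Decomposition into normalizing elements *)

Section Decomposition.
Variables (L : finPartialGroupType) (p : nat).
Variables (Delta : {set {set L}}) (S : {set L}) (loc : locality p Delta S).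
Hypothesis p_pr : prime p.
Implicit Types (a b g h x y : L) (u v w : seq L) (A H P R X Y : {set L}).

Local Notation via := (via Delta).
Local Notation link := (link Delta).

(** The subgroup Q_i attached to a factor g_i is forced to be S_(g_i), so no separate Q is
    recorded. *)
Definition elementary g :=
  (essential loc (S_elt S g) \/ S_elt S g = S) /\ g \in pnorm (S_elt S g).

Definition decomposable g := exists w,
  [/\ forall y, y \in w -> elementary y, pdom w,
      S_word S w = S_elt S g & part_prod w = g].

Lemma S_word1 g : S_word S [:: g] = S_elt S g.
Proof.
apply/setP=> a; rewrite S_word_cons [pconj a g \in _]inE andbT.
by rewrite inE /conj_in -!andbA andbb.
Qed.

Lemma elementary_decomposable g : elementary g -> decomposable g.
Proof.
move=> eg; exists [:: g]; split; rewrite ?pdom1 ?S_word1 ?part_prod1 //.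
by move=> y; rewrite inE => /eqP->.
Qed.

(** By [S_word_cat], replacing a letter by its decomposition changes neither S_u nor the product; by
    [pdom_S_word] the new word is still in the domain. *)
Lemma decomposable_word u : pdom u -> (forall y, y \in u -> decomposable y) ->
  exists w, [/\ forall y, y \in w -> elementary y, pdom w,
    S_word S w = S_word S u & part_prod w = part_prod u].
Proof.
elim: u => [|g u IH] Du decu; first by exists [::].
have [w1 [e1 D1 S1 P1]] := decu g (mem_head g u).
have [|y yu|w2 [e2 D2 S2 P2]] := IH; first exact: (@pdom_suffix _ [:: g]).
  by apply: decu; rewrite inE yu orbT.
have Sw : S_word S (w1 ++ w2) = S_word S (g :: u).
  by apply/setP=> a; rewrite (S_word_cat loc) // S_word_cons S1 S2 P1.
have Dw : pdom (w1 ++ w2).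
  by rewrite (pdom_S_word loc) Sw -(pdom_S_word loc).
exists (w1 ++ w2); split=> //.
  by move=> y; rewrite mem_cat => /orP[/e1|/e2].
by rewrite part_prod_cat // P1 P2 (@part_prod_cat _ [:: g] u) // part_prod1.
Qed.

(** S_u always lies in S_g for g the product of u, so only the opposite inclusion has to be
    assumed. *)
Lemma decomposable_prod u g : pdom u -> (forall y, y \in u -> decomposable y) ->
  S_elt S g \subset S_word S u -> part_prod u = g -> decomposable g.
Proof.
move=> Du decu sgu Eg; have [w [ew Dw Sw Pw]] := decomposable_word Du decu.
exists w; split; rewrite ?Pw // Sw; apply/eqP; rewrite eqEsubset sgu andbT.
by apply/subsetP=> a /(S_word_prod loc Du)[]; rewrite Eg.
Qed.

Lemma via_norm_word R w : R \in Delta -> (forall y, y \in w -> y \in pnorm R) ->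
  link R w R.
Proof.
move=> RD; elim: w => [|y w IH] Nw; first by split; rewrite //= RD.
have [vy Ey] := via_norm RD (Nw y (mem_head _ _)).
apply: (link_cat (u := [:: y])); first by split; [exact: vy | exact: Ey].
by apply: IH => z zw; rewrite Nw // inE zw orbT.
Qed.

Lemma norm_decomposable R x : fully_normalized loc R -> R != S ->
    x \in pnorm R -> S_elt S x = R ->
    (forall y, y \in pnorm R -> R \proper S_elt S y -> decomposable y) ->
  decomposable x.
Proof.
case=> RD sylR nRS xN Sx IH; set sgN := pnorm_subgroup loc RD in sylR.
have sgR := Delta_subgroup loc RD; have sRS := Delta_sub loc RD.
have sRN := sub_pnorm sgR.
pose G := [set: subgroup_type sgN]%G.
pose T := Group (to_subgroup_group_set sgN (locS_subgroup loc)).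
have sylT : p.-Sylow(G) T := sylR.
pose B := Group (to_subgroup_group_set sgN sgR).
have nsBG : B <| G.
  rewrite /normal subsetT; apply/subsetP=> y _; rewrite inE.
  apply/subsetP=> _ /imsetP[r rB ->]; rewrite inE in rB.
  by rewrite inE val_sgJ; apply: pnorm_conj rB; apply: (valP y).
have ltBT : B \proper T.
  have := psubgroup_norm_grows (loc_S loc) sgR (proper_S loc RD nRS).
  rewrite !properE to_subgroup_sub // sRS => /andP[_]; apply: contra.
  move/subsetP=> sTB; apply/subsetP=> y /setIP[yS yN].
  by have := sTB (Sub y yN); rewrite !inE SubK; apply.
have [HG|nHG] := eqVneq <<overlap G T B>> G; last first.
  apply: elementary_decomposable; rewrite /elementary Sx; split=> //; left.
  exists RD; split; first exact: sylR.
  exists (<<overlap G T B>> / B)%G.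
  apply: (overlap_strongly_embedded p_pr sylT nsBG ltBT).
  by rewrite properEneq nHG subsetT.
have : (Sub x xN : subgroup_type sgN) \in <<overlap G T B>> by rewrite HG inE.
(* In a finite group generation needs no inverses: x is a product of elements of the overlap. *)
case/gen_prodgP=> n [c cX Ex].
pose u : seq L := [seq val (c i) | i <- index_enum 'I_n].
have Nu y : y \in u -> y \in pnorm R by case/mapP=> i _ ->; apply: valP.
have [vu _] := via_norm_word RD Nu.
apply: (decomposable_prod (u := u)); first exact: (via_pdom loc vu).
- move=> y yu; apply: IH; first exact: Nu.
  have yN := Nu y yu; case/mapP: yu yN => i _ -> yN.
  (* An element t of the intersection outside R lies in S_y, which makes S_y larger than R. *)
  have /setIdP[_ /properP[_ [t /setIP[tT tTy] tB]]] := cX i.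
  rewrite properE; apply/andP; split.
    by have [+ _] := via_norm RD yN; rewrite (via1E loc) => /andP[].
  apply/subsetPn; exists (val t); last by rewrite inE in tB.
  rewrite mem_conjgV !inE val_sgJ in tTy tT.
  rewrite inE /conj_in tT tTy andbT.
  by case: (is_subgroup_conj sgN (valP t) (valP (c i))).
(* All letters of u normalize R, so R starts a chain for u, and S_x = R lies in S_u. *)
- by move: vu; rewrite Sx (viaE loc) => /andP[].
- by rewrite /u map_comp -val_sg_prod big_map -Ex.
Qed.

Lemma all_decomposable g : decomposable g.
Proof.
have [n] := ubnP (#|S| - #|S_elt S g|); elim: n g => // n IH0 g /ltnSE leSn.
have IH y : #|S_elt S g| < #|S_elt S y| -> decomposable y.
  move=> lty; apply: IH0; apply: leq_trans leSn; rewrite ltn_sub2l //.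
  exact: leq_trans lty (subset_leq_card (S_elt_sub S y)).
set P := S_elt S g in IH leSn *.
have PD : P \in Delta by apply: S_elt_Delta loc g.
have vg : via P [:: g] := via_S_elt loc g; have /via1P[_ Dg QD] := vg.
set Q := conj_set P g in QD *; have cQ : #|Q| = #|P| := card_conj_set Dg.
(* If S_g = S, then S^g lies in S and has the same order, so g normalizes S. *)
have [PS|nPS] := eqVneq P S.
  apply: elementary_decomposable; rewrite /elementary -/P.
  split; first by right.
  rewrite inE Dg eqEcard -/Q cQ leqnn andbT PS.
  exact: (Delta_sub loc QD).
have nQS : Q != S.
  apply: contra_neq nPS => QS; apply/eqP.
  by rewrite eqEcard (Delta_sub loc PD) -cQ QS /=.
have sgP := Delta_subgroup loc PD; have sgQ := Delta_subgroup loc QD.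
have norm_p X (XD : X \in Delta) : is_psubgroup p (S :&: pnorm X).
  apply: (psubgroup_sub (loc_S loc)); last exact: subsetIl.
  exact: (Delta_subgroup loc (norm_S_Delta loc XD)).
have [h0 vh0 fnR] := exists_fully_normalized loc PD.
have [h [vh Eh DAh sAhS]] := conj_into_S vh0 fnR (norm_p P PD) (subsetIr _ _).
set R := conj_set P h0 in fnR Eh; have [RD _] := fnR.
have lg : link P [:: g] Q by split.
have lh : link P [:: h] R by split.
(* Q is led to R through P. The product is only the input for [conj_into_S], which replaces it by a
   k defined on N_S(Q). *)
have [vg' Eg'] : link Q [:: pinv g; h] R.
  by apply: (link_cat (u := [:: _])) lh; apply: link_inv.
have [vk0 Ek0] := via_prod loc vg'; rewrite Eg' in Ek0.
have fnk0 : fully_normalized loc (conj_set Q (part_prod [:: pinv g; h])).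
  by rewrite Ek0.
have [k [vk Ek DBk sBkS]] := conj_into_S vk0 fnk0 (norm_p Q QD) (subsetIr _ _).
rewrite Ek0 in Ek; have lk : link Q [:: k] R by split.
have lx : link R [:: pinv h; g; k] R.
  apply: (link_cat (u := [:: _])); first exact: (link_inv lh).
  exact: (link_cat (u := [:: _])) lg lk.
have [vx Ex] := lx; have [] := via_prod loc vx; rewrite Ex.
set x := part_prod [:: pinv h; g; k] => vRx ExR.
have lu : link P [:: h; x; pinv k] Q.
  apply: (link_cat (u := [:: _])) lh _.
  apply: (link_cat (u := [:: _]) (Y := R)).
    by split.
  exact: link_inv.
have Du := link_pdom loc lu.
have cR : #|R| = #|P| by rewrite -Eh; apply: card_via vh.
apply: (decomposable_prod Du).
- move=> y; rewrite !inE => /or3P[] /eqP->.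
  + apply: IH; apply: leq_trans (proper_card _) (subset_leq_card _).
      exact: psubgroup_norm_grows (loc_S loc) sgP (proper_S loc PD nPS).
    by apply/S_eltSP; rewrite ?subsetIl.
  + have sRx : R \subset S_elt S x.
      by move: vRx; rewrite (via1E loc) => /andP[].
    have [Sx|nSx] := eqVneq (S_elt S x) R; last first.
      by apply: IH; rewrite -cR proper_card // properEneq eq_sym nSx.
    apply: norm_decomposable fnR _ _ Sx _.
    * apply: contra_neq nPS => RS; apply/eqP.
      by rewrite eqEcard (Delta_sub loc PD) -cR RS /=.
    * by have /via1P[_ D _] := vRx; rewrite inE D ExR /=.
    by move=> z _ /proper_card; rewrite cR; apply: IH.
  (* The inverse of k is defined on N_S(Q)^k, whose order exceeds |Q| = |P|. *)
  + have [DBk' EBk'] := conj_setK DBk.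
    apply: IH; rewrite -cQ.
    apply: leq_trans (subset_leq_card (A := conj_set (S :&: pnorm Q) k) _).
      rewrite card_conj_set //; apply: proper_card.
      exact: psubgroup_norm_grows (loc_S loc) sgQ (proper_S loc QD nQS).
    by apply/S_eltSP; rewrite // DBk' EBk' subsetIl.
- have [vu _] := lu; by move: vu; rewrite (viaE loc) => /andP[].
(* Expanding x gives a word that runs through P, R, P, Q, R, Q and cancels to g. *)
have D5 : pdom [:: h; pinv h; g; k; pinv k].
  apply: (link_pdom loc (X := P) (Y := Q)).
  apply: (link_cat (u := [:: _])) lh _.
  apply: (link_cat (u := [:: _; _; _])) lx _.
  exact: link_inv.
have [_ /= <-] := @part_prod_subst L [:: h] [:: pinv h; g; k] [:: pinv k] D5.
have [D3 /= ->] := @part_prod_subst L [::] [:: h; pinv h; g] [:: k; pinv k] D5.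
have E : part_prod [:: h; pinv h; g] = g.
  exact/part_prodKl/(@pdom_prefix _ [:: h; pinv h; g] _ D5).
by rewrite E in D3 *; rewrite part_prodKr.
Qed.

End Decomposition.

Theorem theorem2p4 (p : nat) (L : finPartialGroupType)
    (Delta : {set {set L}}) (S : {set L})
    (p_prime : prime p) (loc : locality p Delta S) (g : L) :
  exists (n : nat) (Q : 'I_n -> {set L}) (w : n.-tuple L),
    [/\ 0 < n,
        forall i, essential loc (Q i) \/ Q i = S,
        pdom w,
        forall i, tnth w i \in pnorm (Q i) /\ S_elt S (tnth w i) = Q i
      & S_word S w = S_elt S g /\ g = part_prod w].
Proof.
suff [w [w0 ew Dw Sw Pw]] : exists w : seq L,
    [/\ w != [::], forall y, y \in w -> elementary loc y, pdom w,
        S_word S w = S_elt S g & part_prod w = g].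
  exists (size w), (fun i => S_elt S (tnth (in_tuple w) i)), (in_tuple w).
  split=> // [|i|i]; first by case: w w0 {ew Dw Sw Pw}.
    by have [] := ew _ (mem_tnth i (in_tuple w)).
  by split=> //; have [] := ew _ (mem_tnth i (in_tuple w)).
have [[|y w] [ew Dw Sw Pw]] := all_decomposable loc p_prime g; last first.
  by exists (y :: w).
(* An empty decomposition means that g is the unit and S_g = S. As n must be positive, the word with
   the single letter g, attached to S, is used instead. *)
have SgS : S_elt S g = S.
  by rewrite -Sw; apply/setP=> a; rewrite inE andbT.
exists [:: g]; split; rewrite ?pdom1 ?S_word1 ?part_prod1 //.
move=> y; rewrite inE => /eqP->; split; first by right.
by have [D1 E1] := conj_set1 S; rewrite SgS -Pw inE D1 E1 eqxx.
Qed.
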